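(* For any attention state $(M,w)$, its Kripke rendition $K(M,w)$ is (i) an epistemic state; (ii) isomorphic to $(M,w)$; and (iii) such that for all $\varphi\in\mathcal{L}$, $K(M,w)\vDash\varphi$ iff $(M,w)\vDash\varphi$.
   Context: Language. $I\neq\emptyset$ is a finite set of agents, $N\in\mathbb{N}$ an attention bound, $\Phi$ a countable set of proposition atoms, $\Psi=\{(\alpha_i<n),(\alpha_i=n): n\le N, i\in I\}$ the set of attention atoms, $At=\Phi\uplus\Psi$. The language $\mathcal{L}$ is $\varphi::=\top\mid p\mid\neg\varphi\mid\varphi\wedge\varphi\mid K_i\varphi$ with $p\in At$, $i\in I$. Attention states. An attention model is $M=(W,R,V,A)$ with $W\ne\emptyset$ a finite set of worlds; $R$ assigning to each $i\in I$ an equivalence relation $R_i$ on $W$; $V:At\to\mathcal{P}(W)$ a valuation; and $A:I\times W\to\{0,\dots,N\}$ such that $wR_iv$ implies $A_i(w)=A_i(v)$. For $w\in W$, $(M,w)$ is an attention state. Satisfaction: $M,w\vDash p$ iff $w\in V(p)$ for $p\in\Phi$; $M,w\vDash(\alpha_i=n)$ iff $A_i(w)=n$; $M,w\vDash(\alpha_i<n)$ iff $A_i(w)<n$; $M,w\vDash K_i\varphi$ iff $M,v\vDash\varphi$ for all $v$ with $wR_iv$; standard clauses for $\top,\neg,\wedge$. (So the values of $V$ on $\Psi$ play no role.) Epistemic states. An epistemic Kripke model is $K=(W,R,V)$ with $W\neq\emptyset$ finite, $R$ assigning to each $i\in I$ an equivalence relation $R_i$ on $W$, and $V:At\to\mathcal{P}(W)$;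 for $w\in W$, $(K,w)$ is an epistemic state. Satisfaction of $\mathcal{L}$-formulas at epistemic states: $K,w\vDash p$ iff $w\in V(p)$ for all $p\in\Phi\cup\Psi$; $K,w\vDash K_i\varphi$ iff $K,v\vDash\varphi$ for all $v$ with $wR_iv$; standard clauses for $\top,\neg,\wedge$. The Kripke rendition of $(M,w)=((W,R,V,A),w)$ is $K(M,w)=((W,R,V_A),w)$ with $V_A(p)=\{v\in W: M,v\vDash p\}$ for all $p\in\Phi\cup\Psi$. Isomorphic means: there is a bijection between the sets of worlds that maps actual world to actual world, preserves and reflects each relation $R_i$, and is such that corresponding worlds satisfy the same atoms of $At$. *)

(* Defs.v *)
From HB Require Import structures.
From mathcomp Require Import all_boot.
Set Implicit Arguments.
Unset Strict Implicit.
Unset Printing Implicit Defensive.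

(* The constructors PropAtom, AttLt and AttEq have disjoint images, so the    *)
(* type is At = Phi (+) Psi; the bound n <= N is carried by 'I_N.+1.          *)
Inductive atom (I : finType) (N : nat) (Phi : countType) : Type :=
  | PropAtom of Phi
  | AttLt of I & 'I_N.+1
  | AttEq of I & 'I_N.+1.

Inductive formula (I : finType) (N : nat) (Phi : countType) : Type :=
  | Top
  | Atom of atom I N Phi
  | Neg of formula I N Phi
  | And of formula I N Phi & formula I N Phi
  | Know of I & formula I N Phi.

Arguments Top {I N Phi}.

(* am_val is also defined on the attention atoms, but att_sat never reads it  *)
(* there.                                                                     *)
Record attention_model (I : finType) (N : nat) (Phi : countType) :=
  AttentionModel {
    am_world : finType;
    am_rel : I -> rel am_world;
    am_val : atom I N Phi -> {set am_world};
    am_att : I -> am_world -> 'I_N.+1;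
    am_nonempty : 0 < #|am_world|;
    am_equiv : forall i, equivalence_rel (am_rel i);
    am_att_rel : forall i w v, am_rel i w v -> am_att i w = am_att i v
  }.

Record attention_state (I : finType) (N : nat) (Phi : countType) :=
  AttentionState {
    as_model : attention_model I N Phi;
    as_point : am_world as_model
  }.

Fixpoint att_sat (I : finType) (N : nat) (Phi : countType)
    (M : attention_model I N Phi) (w : am_world M)
    (phi : formula I N Phi) : bool :=
  match phi with
  | Top => true
  | Atom (PropAtom p) => w \in am_val M (PropAtom I N p)
  | Atom (AttLt i n) => am_att i w < n
  | Atom (AttEq i n) => am_att i w == n
  | Neg psi => ~~ att_sat w psi
  | And psi chi => att_sat w psi && att_sat w chi
  | Know i psi => [forall v, am_rel i w v ==> att_sat v psi]
  end.

(* The conditions making this an epistemic Kripke model are kept apart, in    *)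
(* is_epistemic_model, so that being one is a property to be established      *)
(* rather than a matter of typing.                                            *)
Record kripke_structure (I : finType) (N : nat) (Phi : countType) :=
  KripkeStructure {
    km_world : finType;
    km_rel : I -> rel km_world;
    km_val : atom I N Phi -> {set km_world}
  }.

Record pointed_structure (I : finType) (N : nat) (Phi : countType) :=
  PointedStructure {
    ps_model : kripke_structure I N Phi;
    ps_point : km_world ps_model
  }.

Definition is_epistemic_model (I : finType) (N : nat) (Phi : countType)
    (K : kripke_structure I N Phi) : Prop :=
  0 < #|km_world K| /\ forall i, equivalence_rel (@km_rel _ _ _ K i).

Definition is_epistemic_state (I : finType) (N : nat) (Phi : countType)
    (E : pointed_structure I N Phi) : Prop :=
  is_epistemic_model (ps_model E).

Fixpoint epi_sat (I : finType) (N : nat) (Phi : countType)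
    (K : kripke_structure I N Phi) (w : km_world K)
    (phi : formula I N Phi) : bool :=
  match phi with
  | Top => true
  | Atom p => w \in km_val K p
  | Neg psi => ~~ epi_sat w psi
  | And psi chi => epi_sat w psi && epi_sat w chi
  | Know i psi => [forall v, km_rel i w v ==> epi_sat v psi]
  end.

Definition kripke_rendition_model (I : finType) (N : nat) (Phi : countType)
    (M : attention_model I N Phi) : kripke_structure I N Phi :=
  @KripkeStructure I N Phi (am_world M) (@am_rel _ _ _ M)
    (fun p => [set v | att_sat v (Atom p)]).

Definition kripke_rendition (I : finType) (N : nat) (Phi : countType)
    (S : attention_state I N Phi) : pointed_structure I N Phi :=
  @PointedStructure I N Phi (kripke_rendition_model (as_model S)) (as_point S).

Definition isomorphic (I : finType) (N : nat) (Phi : countType)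
    (E : pointed_structure I N Phi) (S : attention_state I N Phi) : Prop :=
  exists f : km_world (ps_model E) -> am_world (as_model S),
    [/\ bijective f,
        f (ps_point E) = as_point S,
        forall i u v, km_rel i u v <-> am_rel i (f u) (f v)
      & forall u (p : atom I N Phi),
          epi_sat u (Atom p) <-> att_sat (f u) (Atom p)].

(* Main.v *)
Require Import Defs.
From HB Require Import structures.
From mathcomp Require Import all_boot.
Set Implicit Arguments.
Unset Strict Implicit.
Unset Printing Implicit Defensive.

(** The rendition keeps the worlds and relations of [M] and makes each atom, attention atoms
    included, true exactly where [M] satisfies it. Truth thus agrees on atoms by construction, and
    induction on formulas extends this to [Know], which quantifies over the same accessible worlds
    in both. *)

Lemma epi_sat_kripke_rendition (I : finType) (N : nat) (Phi : countType)
    (M : attention_model I N Phi) (phi : formula I N Phi) (w : am_world M) :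
  @epi_sat I N Phi (kripke_rendition_model M) w phi = att_sat w phi.
Proof.
(* The world [w] stays general, since [Know] evaluates its argument at other worlds. *)
elim: phi w => [|p|psi IH|psi IHpsi chi IHchi|i psi IH] w //=.
- by rewrite inE.
- by rewrite IH.
- by rewrite IHpsi IHchi.
- by apply: eq_forallb => v; rewrite IH.
Qed.

Theorem proposition13 (I : finType) (N : nat) (Phi : countType)
    (hI : 0 < #|I|) (S : attention_state I N Phi) :
  [/\ is_epistemic_state (kripke_rendition S),
      isomorphic (kripke_rendition S) S
    & forall phi : formula I N Phi,
        epi_sat (ps_point (kripke_rendition S)) phi
          <-> att_sat (as_point S) phi].
Proof.
split; last by move=> phi; rewrite epi_sat_kripke_rendition.
- by split; [exact: am_nonempty | exact: am_equiv].
(* Worlds, point and relations coincide definitionally, so the identity serves; only atoms need the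
   lemma. *)
- exists id; split=> //; first by exists id.
  by move=> u p; rewrite epi_sat_kripke_rendition.
Qed.
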